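(* Let $\mathcal{G}$ be a finite non-trivial group, $P=P(\mathcal{G})$ its group planar algebra, $A_G^3=\bigoplus_{m\ge 0}P_{(2m+3,+)}$ the graded algebra of the two-sided Guionnet-Jones-Shlyakhtenko construction at level $3$, and $Z\in P_{(5,+)}$ the distinguished self-adjoint Temperley-Lieb element described in the context. Then the algebra $A_G^3$ is generated by $Z$ and $P_{(3,+)}$.
   Context: **Group planar algebra.** For a finite group $\mathcal{G}$ of order $n$, $P(\mathcal{G})$ is the group planar algebra: the irreducible subfactor planar algebra with modulus $\delta=\sqrt n$ associated with the fixed-point subfactor $R^{\mathcal G}\subset R$ of an outer action of $\mathcal G$ on the hyperfinite $II_1$ factor $R$. It has $P_{(2,+)}=\mathbb{C}\mathcal{G}$ (stacking of 2-boxes is group multiplication, $g^*=g^{-1}$, the identity tangle is $e$) and $\dim P_{(k,\pm)}=n^{k-1}$ for $k\ge 1$. A concrete model: $P_{(k,+)}$ ($k\ge1$) consists of the functions $\mathcal{G}^k\to\mathbb{C}$ invariant under diagonal left translation, where a $(k,+)$-box has $2k$ boundary points, its marked boundary interval is unshaded, and the $k$ arguments are spins on its $k$ shaded boundary intervals. A tangle, drawn with all boxes rectangular with half of their points on top, half on the bottom and the marked interval at the left, acts by summing over assignments of elements of $\mathcal{G}$ to internal shaded regions (spins on regions touching the external boundary being the arguments of the output) the product of the values of the box labels, times a factor $n^{-1/4}$ (resp. $n^{1/4}$) for each local maximum or minimum of a string whose concave side is shaded (resp. unshaded). The adjoint $*$ is mirror reflection with complex conjugation. $P_{(0,\pm)}=\mathbb{C}$,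 and each closed loop contributes $\delta$. **Graded algebra $A_G^k$.** For $k\ge0$, $A_G^k=\bigoplus_{m\ge0}A^k_m$ with $A^k_m=P_{(2m+k,+)}$. An element of $A^k_m$ is drawn as a box with $k$ strings on the left side, $k$ on the right side, $2m$ on the top and $2m$ on the bottom, with marked interval at the top-left corner. The graded product of $a\in A^k_m$ and $b\in A^k_{m'}$ is the concatenation $a\cdot b\in A^k_{m+m'}$: place $a$ to the left of $b$ and join the $k$ right strings of $a$ to the $k$ left strings of $b$, the top (bottom) strings of $a$ followed by those of $b$ becoming the top (bottom) strings of the product. The involution $\dagger$ is, on each $A^k_m$, the planar algebra adjoint (mirror reflection exchanging left and right) followed by the rotation returning the marked interval to the top-left corner. In particular $P_{(3,+)}=A^3_0$ is a unital subalgebra of $A^3_G$. **The element $Z$.** $Z\in A^3_1=P_{(5,+)}$ is the Temperley-Lieb diagram in which, with left points $L_1,L_2,L_3$ and right points $R_1,R_2,R_3$ numbered from top to bottom, top points $T_1,T_2$ and bottom points $B_1,B_2$ numbered from left to right, the strings join $L_1$–$T_1$, $T_2$–$R_1$, $L_2$–$R_2$, $L_3$–$B_1$, $B_2$–$R_3$. *)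

(* Defs.v *)
From HB Require Import structures.
From mathcomp Require Import all_boot all_order all_algebra all_fingroup.
From mathcomp Require Import complex.
From mathcomp Require Import boolp classical_sets reals.

Set Implicit Arguments.
Unset Strict Implicit.
Unset Printing Implicit Defensive.

Import GRing.Theory Num.Theory Num.Def.

Local Open Scope ring_scope.

(* A (K,+)-box has 2K boundary points, numbered 0, ..., 2K-1 clockwise from the
   marked interval, which is unshaded.  Hence its shaded boundary intervals are
   the intervals [2j, 2j+1], and are indexed by j : 'I_K. *)
Definition spins (gT : finGroupType) (K : nat) := {ffun 'I_K -> gT}.

Definition translate (gT : finGroupType) (T : finType) (g : gT)
  (s : {ffun T -> gT}) : {ffun T -> gT} := [ffun j => (g * s j)%g].

Definition left_invariant (R : realType) (gT : finGroupType) (K : nat) :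
    {pred {ffun spins gT K -> R[i]^o}} :=
  fun f => [forall g : gT, forall s, f (translate g s) == f s].

Lemma left_invariantP (R : realType) (gT : finGroupType) (K : nat)
    (f : {ffun spins gT K -> R[i]^o}) :
  reflect (forall g s, f (translate g s) = f s) (f \in @left_invariant R gT K).
Proof.
apply: (iffP forallP) => fP g; first by move=> s; apply/eqP/(forallP (fP g)).
by apply/forallP => s; apply/eqP.
Qed.

Lemma left_invariant_submod (R : realType) (gT : finGroupType) (K : nat) :
  submod_closed (@left_invariant R gT K).
Proof.
split=> [|a u v /left_invariantP uP /left_invariantP vP].
  by apply/left_invariantP => g s; rewrite !ffunE.
by apply/left_invariantP => g s; rewrite !ffunE uP vP.
Qed.

HB.instance Definition _ (R : realType) (gT : finGroupType) (K : nat) :=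
  GRing.isSubmodClosed.Build R[i] {ffun spins gT K -> R[i]^o}
    (@left_invariant R gT K) (@left_invariant_submod R gT K).

(* P_(K,+) of the group planar algebra, in the spin model: the functions of the
   spins on the K shaded boundary intervals that are invariant under diagonal
   left translation.  The complex numbers are R[i]. *)
Record box (R : realType) (gT : finGroupType) (K : nat) := Box {
  box_val :> {ffun spins gT K -> R[i]^o};
  box_valP : box_val \in @left_invariant R gT K
}.

HB.instance Definition _ (R : realType) (gT : finGroupType) (K : nat) :=
  [isSub for @box_val R gT K].
HB.instance Definition _ (R : realType) (gT : finGroupType) (K : nat) :=
  [Choice of box R gT K by <:].
HB.instance Definition _ (R : realType) (gT : finGroupType) (K : nat) :=
  [SubChoice_isSubLmodule of box R gT K by <:].

(* A boundary point of one of the discs of a tangle: None is the output disc,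
   Some j are the input discs, and disc i is a (K i,+)-box. *)
Definition point (J : finType) (K : option J -> nat) :=
  {i : option J & 'I_(K i).*2}.

(* strings p q means that a string joins p to q; each string needs to be listed
   in one direction only.  Since [act] identifies the regions with the classes
   of boundary intervals linked by strings, tangles must have no closed loop
   and every shaded region must be a disc.  The last two fields count the local
   maxima and minima of the strings whose concave side is shaded, respectively
   unshaded, in a drawing where all the boxes are rectangles with half of their
   points on top, half on the bottom, and the marked interval at the left. *)
Record tangle (J : finType) (K : option J -> nat) := Tangle {
  strings : rel (point K);
  shaded_extrema : nat;
  unshaded_extrema : nat
}.

(* A state assigns a spin to every shaded boundary interval of every disc. *)
Definition state (gT : finGroupType) (J : finType) (K : option J -> nat) :=
  {ffun {i : option J & 'I_(K i)} -> gT}.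

Definition restr (gT : finGroupType) (J : finType) (K : option J -> nat)
    (sg : state gT K) (i : option J) : spins gT (K i) :=
  [ffun j => sg (Tagged (fun i => 'I_(K i)) j)].

Lemma half_ord_subproof (K : nat) (p : 'I_K.*2) : (p./2 < K)%N.
Proof. by rewrite ltn_half_double. Qed.

Definition half_ord (K : nat) (p : 'I_K.*2) : 'I_K :=
  Ordinal (half_ord_subproof p).

(* The spin on the only shaded interval that ends at p. *)
Definition spin_at (gT : finGroupType) (J : finType) (K : option J -> nat)
    (sg : state gT K) (p : point K) : gT :=
  restr sg (tag p) (half_ord (tagged p)).

(* The spin is constant on each shaded region: the shaded intervals that end at
   the two endpoints of a string bound the same region. *)
Definition compatible (gT : finGroupType) (J : finType) (K : option J -> nat)
    (T : tangle K) (sg : state gT K) : bool :=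
  [forall p, forall q, strings T p q ==> (spin_at sg p == spin_at sg q)].

(* n^((u - s)/4), where s and u are the numbers of extrema of T. *)
Definition extrema_weight (R : realType) (gT : finGroupType) (J : finType)
    (K : option J -> nat) (T : tangle K) : R[i] :=
  (4.-root #|gT|%:R) ^+ unshaded_extrema T / (4.-root #|gT|%:R) ^+ shaded_extrema T.

Definition act_fun (R : realType) (gT : finGroupType) (J : finType)
    (K : option J -> nat) (T : tangle K)
    (f : forall j, box R gT (K (Some j))) : {ffun spins gT (K None) -> R[i]^o} :=
  [ffun s => extrema_weight R gT T *
     \sum_(sg : state gT K | compatible T sg && (restr sg None == s))
        \prod_(j : J) f j (restr sg (Some j))].

Lemma translateK (gT : finGroupType) (T : finType) (g : gT) :
  cancel (@translate gT T g) (translate g^-1%g).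
Proof. by move=> s; apply/ffunP => j; rewrite !ffunE mulKg. Qed.

Lemma translateVK (gT : finGroupType) (T : finType) (g : gT) :
  cancel (@translate gT T g^-1%g) (translate g).
Proof. by move=> s; apply/ffunP => j; rewrite !ffunE mulKVg. Qed.

Lemma restr_translate (gT : finGroupType) (J : finType) (K : option J -> nat)
    (g : gT) (sg : state gT K) (i : option J) :
  restr (translate g sg) i = translate g (restr sg i).
Proof. by apply/ffunP => j; rewrite !ffunE. Qed.

Lemma compatible_translate (gT : finGroupType) (J : finType)
    (K : option J -> nat) (T : tangle K) (g : gT) (sg : state gT K) :
  compatible T (translate g sg) = compatible T sg.
Proof.
apply: eq_forallb => p; apply: eq_forallb => q; congr (_ ==> _).
by rewrite /spin_at !restr_translate !ffunE (inj_eq (mulgI g)).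
Qed.

Lemma act_subproof (R : realType) (gT : finGroupType) (J : finType)
    (K : option J -> nat) (T : tangle K) (f : forall j, box R gT (K (Some j))) :
  act_fun T f \in @left_invariant R gT (K None).
Proof.
apply/left_invariantP => g s; rewrite !ffunE; congr (_ * _).
rewrite (reindex_inj (can_inj (@translateK gT _ g))) /=.
apply: eq_big => [sg | sg _].
  by rewrite compatible_translate restr_translate (can_eq (@translateK gT _ g)).
apply: eq_bigr => j _; rewrite restr_translate.
exact: (left_invariantP _ (box_valP (f j))).
Qed.

Definition act (R : realType) (gT : finGroupType) (J : finType)
    (K : option J -> nat) (T : tangle K) (f : forall j, box R gT (K (Some j))) :
  box R gT (K None) := Box (act_subproof T f).

(* The component A^k_m = P_(2m+k,+) of A_G^k. *)
Definition gjs_box (R : realType) (gT : finGroupType) (k m : nat) :=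
  box R gT (m.*2 + k).

HB.instance Definition _ (R : realType) (gT : finGroupType) (k m : nat) :=
  GRing.Lmodule.on (gjs_box R gT k m).

Variant side := Top | Right | Bottom | Left.

(* Translates the clockwise number of a boundary point of a box of A^k_m, with
   marked interval at the top-left corner, into a side and a rank on that side.
   Ranks start at 0 and go from left to right or from top to bottom. *)
Definition label (k m p : nat) : side * nat :=
  if (p < m.*2)%N then (Top, p)
  else if (p < m.*2 + k)%N then (Right, p - m.*2)%N
  else if (p < m.*2 + k + m.*2)%N then (Bottom, (m.*2 + k + m.*2).-1 - p)%N
  else (Left, ((m.*2 + k).*2).-1 - p)%N.

Definition mul_degree (m m' : nat) (i : option bool) : nat :=
  match i with None => m + m' | Some false => m | Some true => m' end.

(* The strings of the product of a (disc Some false) by b (disc Some true). *)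
Definition mul_strings (m : nat) (x y : option bool * (side * nat)) : bool :=
  match x, y with
  | (Some false, (Right, i)), (Some true, (Left, j)) => i == j
  | (None, (Left, i)), (Some false, (Left, j)) => i == j
  | (None, (Right, i)), (Some true, (Right, j)) => i == j
  | (None, (Top, i)), (Some false, (Top, j)) => i == j
  | (None, (Bottom, i)), (Some false, (Bottom, j)) => i == j
  | (None, (Top, i)), (Some true, (Top, j)) => i == (m.*2 + j)%N
  | (None, (Bottom, i)), (Some true, (Bottom, j)) => i == (m.*2 + j)%N
  | _, _ => false
  end.

(* In the rectangular drawing a box of A^k_m has its top and right points, in
   this order, on top, and its left and bottom points on the bottom.  Putting b
   above a, all the strings of the product are vertical: no extrema. *)
Definition mul_tangle (k m m' : nat) :
    tangle (fun i => (mul_degree m m' i).*2 + k)%N :=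
  let lab (p : point (fun i => (mul_degree m m' i).*2 + k)%N) :=
    (tag p, label k (mul_degree m m' (tag p)) (tagged p)) in
  Tangle (fun p q => mul_strings m (lab p) (lab q)) 0 0.

Definition hmul (R : realType) (gT : finGroupType) (k m m' : nat)
    (a : gjs_box R gT k m) (b : gjs_box R gT k m') : gjs_box R gT k (m + m') :=
  act (mul_tangle k m m')
    (fun j => if j is true then b else a).

Definition Z_strings (x y : side * nat) : bool :=
  match x, y with
  | (Left, 0), (Top, 0) => true
  | (Top, 1), (Right, 0) => true
  | (Left, 1), (Right, 1) => true
  | (Left, 2), (Bottom, 0) => true
  | (Bottom, 1), (Right, 2) => true
  | _, _ => false
  end%N.

(* In the rectangular drawing the points are T1 T2 R1 R2 R3 on top and
   L1 L2 L3 B1 B2 on the bottom.  The string T2-R1 has one extremum, whose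
   concave side is the unshaded top-right corner; L3-B1 has one, whose concave
   side is the shaded bottom-left corner; the other strings are vertical. *)
Definition Z_tangle : tangle (fun _ : option void => 1.*2 + 3)%N :=
  Tangle (fun p q => Z_strings (label 3 1 (tagged p)) (label 3 1 (tagged q))) 1 1.

Definition hZ (R : realType) (gT : finGroupType) : gjs_box R gT 3 1 :=
  act Z_tangle (fun j : void => match j with end).

(* A_G^k, the direct sum of the A^k_m. *)
Record gjs (R : realType) (gT : finGroupType) (k : nat) := Gjs {
  gjs_val :> forall m, gjs_box R gT k m;
  gjs_valP : exists N, forall m, (N <= m)%N -> gjs_val m = 0
}.

HB.instance Definition _ (R : realType) (gT : finGroupType) (k : nat) :=
  gen_eqMixin (gjs R gT k).
HB.instance Definition _ (R : realType) (gT : finGroupType) (k : nat) :=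
  gen_choiceMixin (gjs R gT k).

Lemma gjs_ext (R : realType) (gT : finGroupType) (k : nat) (a b : gjs R gT k) :
  (forall m, a m = b m) -> a = b.
Proof.
case: a b => [a aP] [b bP] /= ab; have {}ab := functional_extensionality_dep ab.
by subst b; rewrite (Prop_irrelevance aP bP).
Qed.

Section GjsModule.
Variables (R : realType) (gT : finGroupType) (k : nat).
Implicit Types a b : gjs R gT k.

Lemma gjs_zero_subproof :
  exists N, forall m, (N <= m)%N -> (0 : gjs_box R gT k m) = 0.
Proof. by exists 0%N. Qed.

Lemma gjs_opp_subproof a : exists N, forall m, (N <= m)%N -> - a m = 0.
Proof. by case: (gjs_valP a) => N aN; exists N => m /aN ->; rewrite oppr0. Qed.

Lemma gjs_scale_subproof (c : R[i]) a :
  exists N, forall m, (N <= m)%N -> c *: a m = 0.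
Proof. by case: (gjs_valP a) => N aN; exists N => m /aN ->; rewrite scaler0. Qed.

Lemma gjs_add_subproof a b : exists N, forall m, (N <= m)%N -> a m + b m = 0.
Proof.
case: (gjs_valP a) (gjs_valP b) => N aN [N' bN]; exists (maxn N N') => m.
by rewrite geq_max => /andP[/aN-> /bN->]; rewrite addr0.
Qed.

Definition gjs_zero := Gjs gjs_zero_subproof.
Definition gjs_opp a := Gjs (gjs_opp_subproof a).
Definition gjs_add a b := Gjs (gjs_add_subproof a b).
Definition gjs_scale c a := Gjs (gjs_scale_subproof c a).

Lemma gjs_addA : associative gjs_add.
Proof. by move=> a b c; apply: gjs_ext => m; exact: addrA. Qed.
Lemma gjs_addC : commutative gjs_add.
Proof. by move=> a b; apply: gjs_ext => m; exact: addrC. Qed.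
Lemma gjs_add0 : left_id gjs_zero gjs_add.
Proof. by move=> a; apply: gjs_ext => m; exact: add0r. Qed.
Lemma gjs_addN : left_inverse gjs_zero gjs_opp gjs_add.
Proof. by move=> a; apply: gjs_ext => m; exact: addNr. Qed.

HB.instance Definition _ := GRing.isZmodule.Build (gjs R gT k)
  gjs_addA gjs_addC gjs_add0 gjs_addN.

Lemma gjs_scaleA c d a : gjs_scale c (gjs_scale d a) = gjs_scale (c * d) a.
Proof. by apply: gjs_ext => m; exact: scalerA. Qed.
Lemma gjs_scale1 : left_id 1 gjs_scale.
Proof. by move=> a; apply: gjs_ext => m; exact: scale1r. Qed.
Lemma gjs_scaleDr : right_distributive gjs_scale +%R.
Proof. by move=> c a b; apply: gjs_ext => m; exact: scalerDr. Qed.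
Lemma gjs_scaleDl a : {morph gjs_scale^~ a : c d / c + d}.
Proof. by move=> c d; apply: gjs_ext => m; exact: scalerDl. Qed.

HB.instance Definition _ := GRing.Zmodule_isLmodule.Build R[i] (gjs R gT k)
  gjs_scaleA gjs_scale1 gjs_scaleDr gjs_scaleDl.

End GjsModule.

Lemma hmul0l (R : realType) (gT : finGroupType) (k m m' : nat)
    (b : gjs_box R gT k m') : hmul (0 : gjs_box R gT k m) b = 0.
Proof.
apply: val_inj; apply/ffunP => s; rewrite !ffunE big1 ?mulr0// => sg _.
by rewrite (bigD1 false)//= ffunE mul0r.
Qed.

Lemma hmul0r (R : realType) (gT : finGroupType) (k m m' : nat)
    (a : gjs_box R gT k m) : hmul a (0 : gjs_box R gT k m') = 0.
Proof.
apply: val_inj; apply/ffunP => s; rewrite !ffunE big1 ?mulr0// => sg _.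
by rewrite (bigD1 true)//= ffunE mul0r.
Qed.

Definition gjs_cast (R : realType) (gT : finGroupType) (k m m' : nat)
    (e : m = m') (a : gjs_box R gT k m) : gjs_box R gT k m' :=
  ecast i (gjs_box R gT k i) e a.

Lemma gjs_cast0 (R : realType) (gT : finGroupType) (k m m' : nat)
    (e : m = m') : gjs_cast e (0 : gjs_box R gT k m) = 0.
Proof. by case: m' / e. Qed.

(* The component of degree p is the sum of the products a_i . b_(p-i); the cast
   is along i + (p - i) = p. *)
Definition gjs_mul_fun (R : realType) (gT : finGroupType) (k : nat)
    (a b : gjs R gT k) (p : nat) : gjs_box R gT k p :=
  \sum_(i < p.+1) gjs_cast (subnKC (leq_ord i)) (hmul (a i) (b (p - i)%N)).

Lemma gjs_mul_subproof (R : realType) (gT : finGroupType) (k : nat)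
    (a b : gjs R gT k) :
  exists N, forall p, (N <= p)%N -> gjs_mul_fun a b p = 0.
Proof.
case: (gjs_valP a) (gjs_valP b) => N aN [N' bN]; exists (N + N')%N => p Np.
rewrite /gjs_mul_fun big1// => i _; case: (leqP N i) => [/aN->|iN].
  by rewrite hmul0l gjs_cast0.
rewrite bN ?hmul0r ?gjs_cast0// leq_subRL; last exact: leq_ord.
by rewrite (leq_trans _ Np)// leq_add2r ltnW.
Qed.

Definition gjs_mul (R : realType) (gT : finGroupType) (k : nat)
    (a b : gjs R gT k) : gjs R gT k := Gjs (gjs_mul_subproof a b).

Definition homog_fun (R : realType) (gT : finGroupType) (k m : nat)
    (a : gjs_box R gT k m) (p : nat) : gjs_box R gT k p :=
  if m =P p is ReflectT e then gjs_cast e a else 0.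

Lemma homog_subproof (R : realType) (gT : finGroupType) (k m : nat)
    (a : gjs_box R gT k m) :
  exists N, forall p, (N <= p)%N -> homog_fun a p = 0.
Proof.
by exists m.+1 => p mp; rewrite /homog_fun; case: eqP => // e; rewrite e ltnn in mp.
Qed.

(* The inclusion of the homogeneous component A^k_m into A_G^k. *)
Definition homog (R : realType) (gT : finGroupType) (k m : nat)
    (a : gjs_box R gT k m) : gjs R gT k := Gjs (homog_subproof a).

Definition Z (R : realType) (gT : finGroupType) : gjs R gT 3 := homog (hZ R gT).

(* The unit is not mentioned: it belongs to P_(k,+), hence to every subalgebra
   that contains P_(k,+). *)
Definition is_subalgebra (R : realType) (gT : finGroupType) (k : nat)
    (S : set (gjs R gT k)) : Prop :=
  [/\ S 0,
      forall (c : R[i]) a b, S a -> S b -> S (c *: a + b) &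
      forall a b, S a -> S b -> S (gjs_mul a b)].

Definition generated_subalgebra (R : realType) (gT : finGroupType) (k : nat)
    (X : set (gjs R gT k)) : set (gjs R gT k) :=
  smallest (@is_subalgebra R gT k) X.

(* Main.v *)
Require Import Defs.
From mathcomp Require Import all_boot all_order all_algebra all_fingroup.
From mathcomp Require Import complex.
From mathcomp Require Import boolp classical_sets reals.
From mathcomp Require Import zify.

Set Implicit Arguments.
Unset Strict Implicit.
Unset Printing Implicit Defensive.

Import GRing.Theory Num.Theory.

Local Open Scope ring_scope.

(** An element of the degree m component is a left-invariant function of 2m+3
spins: the spin l of the left region, the spins t_0, ..., t_(m-1) of the top
regions, the spins b_0, ..., b_m of the bottom regions (from the bottom-left to
the bottom-right corner), and the spin r of the right region.

A product a.b sums over the spin x of the one region that becomes internal, the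
region between the two upper strings that join a to b; the bottom-right region
of a and the bottom-left region of b merge and still touch the boundary
([hmulE]). In the diagram of Z, the strings L_1-T_1, T_2-R_1 and L_2-R_2 join
the left, top and right regions, while the two bottom regions stay free:
Z(l; t_0; b_0, b_1; r) is 1 if l = t_0 = r and 0 otherwise ([hZE]). Hence Z
turns both summations into evaluations ([hmul_Z_hmulE]):
  (a.Z.p)(l; t_0..t_m; b_0..b_(m+1); r) =
    a(l; t_0..t_(m-1); b_0..b_m; t_m) p(t_m; b_(m+1); r).

Let a and p be the indicators of two orbits of left translation. Both factors
involve t_m, so the translations that bring their arguments to the given
representatives with t_m = 1 are the same one: the product is the indicator of
an orbit in degree m+1, and every orbit is obtained ([step_productE]). Orbit
indicators span the left-invariant functions ([box_normalize]), so degree m+1 is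
spanned by products of degree m, Z and P_(3,+) ([step_span]), and the theorem
follows by induction on the degree. *)

(** * Spins as functions of a natural number *)

Section Spins.
Variable gT : finGroupType.

(** Functions on nat let boxes of provably but not definitionally equal sizes be
evaluated at the same argument, so that casts disappear ([gjs_castE]). *)
Definition spins_of (K : nat) (f : nat -> gT) : spins gT K :=
  [ffun j : 'I_K => f j].

Definition ext (K : nat) (s : spins gT K) (j : nat) : gT :=
  oapp (fun i : 'I_K => s i) 1%g (insub j).

Lemma ext_ord (K : nat) (s : spins gT K) (j : 'I_K) : ext s j = s j.
Proof. by rewrite /ext valK. Qed.

Lemma ext_spins_of (K : nat) (f : nat -> gT) (j : nat) :
  (j < K)%N -> ext (spins_of K f) j = f j.
Proof. by move=> jK; rewrite (_ : j = Ordinal jK)// ext_ord ffunE. Qed.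

Lemma extK (K : nat) : cancel (@ext K) (spins_of K).
Proof. by move=> s; apply/ffunP => j; rewrite ffunE ext_ord. Qed.

Lemma eq_spins_of (K : nat) (f g : nat -> gT) :
  (forall j, (j < K)%N -> f j = g j) -> spins_of K f = spins_of K g.
Proof. by move=> fg; apply/ffunP => j; rewrite !ffunE fg. Qed.

End Spins.

(** * The product and Z as functions of spins *)

Section Products.
Variables (R : realType) (gT : finGroupType).

Section Glue.
Variables (m m' : nat).

(** The spins seen by the output (None), by a (Some false) and by b (Some true)
in the product a.b, when the output sees f and the internal region has spin x.
Clockwise, the regions of a box of degree m have the numbers 0, ..., m-1 (top),
m (right), m+1, ..., 2m+1 (bottom, from right to left) and 2m+2 (left): the
output first meets the top of b after m intervals, and the bottom-right region
of a after 2m' intervals more than a does. *)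
Definition glue (f : nat -> gT) (x : gT) (i : option bool) (j : nat) : gT :=
  match i with
  | None => f j
  | Some false => if (j < m)%N then f j else if j == m then x else f (j + m'.*2)%N
  | Some true => if (j < m'.*2.+2)%N then f (m + j)%N else x
  end.

Lemma glue_strings f x i i' (p q : nat) :
  (p < (mul_degree m m' i).*2.*2 + 6)%N ->
  (q < (mul_degree m m' i').*2.*2 + 6)%N ->
  mul_strings m (i, label 3 (mul_degree m m' i) p)
    (i', label 3 (mul_degree m m' i') q) ->
  glue f x i p./2 = glue f x i' q./2.
Proof.
rewrite /label /glue; case: i => [[]|]; case: i' => [[]|] //=; move=> hp hq;
  repeat (case: ifP => //= ?); move=> /eqP e; try congr (f _); lia.
Qed.

Let deg (i : option bool) := ((mul_degree m m' i).*2 + 3)%N.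

Definition glue_state (f : nat -> gT) (x : gT) : state gT deg :=
  [ffun ij : {i : option bool & 'I_(deg i)} => glue f x (tag ij) (tagged ij)].

Lemma restr_glue f x i :
  restr (glue_state f x) i = spins_of (deg i) (glue f x i).
Proof. by apply/ffunP => j; rewrite !ffunE. Qed.

Definition state_spin (sg : state gT deg) (i : option bool) : nat -> gT :=
  ext (restr sg i).

Lemma spin_at_ext (sg : state gT deg) i (p : 'I_(deg i).*2) :
  spin_at sg (Tagged (fun i => 'I_(deg i).*2) p) = state_spin sg i p./2.
Proof. by rewrite /spin_at /state_spin /= -ext_ord. Qed.

Lemma compatible_glue f x : compatible (mul_tangle 3 m m') (glue_state f x).
Proof.
apply/forallP => -[i p]; apply/forallP => -[i' q]; apply/implyP => /= pq.
have half_deg i0 (p0 : 'I_(deg i0).*2) : (p0./2 < deg i0)%N.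
  exact: half_ord_subproof.
apply/eqP; rewrite (spin_at_ext _ p) (spin_at_ext _ q) /state_spin !restr_glue.
rewrite !ext_spins_of//; apply: glue_strings pq.
- by have := ltn_ord p; rewrite /deg; lia.
- by have := ltn_ord q; rewrite /deg; lia.
Qed.

Lemma compatible_strings (sg : state gT deg) i i' (p q : nat) :
  compatible (mul_tangle 3 m m') sg ->
  (p < (deg i).*2)%N -> (q < (deg i').*2)%N ->
  mul_strings m (i, label 3 (mul_degree m m' i) p)
    (i', label 3 (mul_degree m m' i') q) ->
  state_spin sg i p./2 = state_spin sg i' q./2.
Proof.
move=> sgP pi qi pq.
move/forallP/(_ (Tagged (fun i => 'I_(deg i).*2) (Ordinal pi))): sgP.
move/forallP/(_ (Tagged (fun i => 'I_(deg i).*2) (Ordinal qi))).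
by move/implyP/(_ pq)/eqP; rewrite !spin_at_ext.
Qed.

(** A compatible state is determined by its output spins and the internal spin:
every interval of a or b off the internal region has an endpoint whose string
goes to the output. *)
Lemma compatible_glued (sg : state gT deg) :
  compatible (mul_tangle 3 m m') sg ->
  sg = glue_state (state_spin sg None) (state_spin sg (Some false) m).
Proof.
move=> sgP; apply/ffunP => -[i j]; rewrite ffunE /=.
have -> : sg (existT _ i j) = state_spin sg i j by rewrite /state_spin ext_ord ffunE.
have := ltn_ord j; move: (nat_of_ord j) => {}j.
have halfD (k : nat) : k = k.*2./2 by rewrite doubleK.
have halfS (k : nat) : k = k.*2.+1./2 by rewrite /= uphalf_double.
rewrite {1}/deg; case: i => [[]|] //= jK.
- case: ifP => jm.
    (* Of the two endpoints 2j and 2j+1, the first one is used: for j = 2m'+1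
       the second one is the lowest left point, which is joined to a. *)
    rewrite [in LHS](halfD j) [in RHS](halfD (m + j)%N).
    apply: esym; apply: (compatible_strings sgP); rewrite /deg /=; try lia.
    by rewrite /label; repeat (case: ifP => //= ?); lia.
  (* The internal region is bounded by the string joining the topmost right
     point of a, numbered 2m, to the topmost left point of b, its last one. *)
  rewrite [in LHS](halfS j) [in RHS](halfD m).
  apply: esym; apply: (compatible_strings sgP); rewrite /deg /=; try lia.
  by rewrite /label; repeat (case: ifP => //= ?); lia.
- case: ifP => jm.
    rewrite [in LHS](halfD j) [in RHS](halfD j).
    apply: esym; apply: (compatible_strings sgP); rewrite /deg /=; try lia.
    by rewrite /label; repeat (case: ifP => //= ?); lia.
  case: eqP => [-> //|jm'].
  (* Here the second endpoint is used: for j = m+1 the first one is the lowest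
     right point, which is joined to b. *)
  rewrite [in LHS](halfS j) [in RHS](halfS (j + m'.*2)%N).
  apply: esym; apply: (compatible_strings sgP); rewrite /deg /=; try lia.
  by rewrite /label; repeat (case: ifP => //= ?); lia.
Qed.

(** The summation over compatible states becomes one over the spin of the internal
region; the weight is 1 as the strings of a product have no extrema. *)
Lemma hmulE (a : gjs_box R gT 3 m) (b : gjs_box R gT 3 m') f :
  hmul a b (spins_of _ f) =
  \sum_x a (spins_of _ (glue f x (Some false))) *
         b (spins_of _ (glue f x (Some true))).
Proof.
rewrite ffunE /extrema_weight !expr0 divr1 mul1r.
rewrite (reindex_onto (glue_state f)
  (fun sg => state_spin sg (Some false) m)) /=; last first.
  move=> sg /andP[sgP /eqP sgf]; rewrite [RHS]compatible_glued// /state_spin sgf.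
  apply/ffunP => -[i j]; rewrite !ffunE /=; have := ltn_ord j.
  rewrite /deg /glue; case: i {j} (nat_of_ord j) => [[]|] /= j jK.
  - by case: ifP => // jm; rewrite ext_spins_of//; lia.
  - by case: ifP => jm; [|case: ifP => // jm']; rewrite ext_spins_of//; lia.
  - by rewrite ext_spins_of.
apply: eq_big => [x|x _]; last by rewrite big_bool !restr_glue mulrC.
rewrite compatible_glue !restr_glue eqxx /state_spin restr_glue.
rewrite ext_spins_of; last by rewrite /deg /=; lia.
by rewrite /glue ltnn !eqxx.
Qed.

End Glue.

(** The two extrema of Z have concave sides of opposite shadings, hence cancelling
weights. The intervals 0, 1 and 4 are the top, right and left ones. *)
Lemma hZE (f : nat -> gT) :
  hZ R gT (spins_of _ f) = ((f 0%N == f 1%N) && (f 1%N == f 4%N))%:R.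
Proof.
rewrite ffunE /extrema_weight !expr1 divff ?mul1r; last first.
  by rewrite rootC_eq0// pnatr_eq0 -lt0n; apply/card_gt0P; exists 1%g.
pose sf : state gT (fun _ : option void => 1.*2 + 3)%N :=
  [ffun ij : {i : option void & 'I_(1.*2 + 3)} => f (tagged ij)].
have restr_sf i : restr sf i = spins_of _ f by apply/ffunP => j; rewrite !ffunE.
have sfE sg : (restr sg None == spins_of _ f) = (sg == sf).
  apply/eqP/eqP => [|->]; last exact: restr_sf.
  by rewrite -(restr_sf None) => /ffunP sgE; apply/ffunP => -[[[]|] j];
    have := sgE j; rewrite !ffunE.
have spin_sf p : spin_at sf p = f (tagged p)./2.
  by rewrite /spin_at restr_sf ffunE.
under eq_bigl do rewrite sfE andbC.
have -> : (f 0%N == f 1%N) && (f 1%N == f 4%N) = compatible Z_tangle sf.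
  apply/andP/idP => [[/eqP f01 /eqP f14]|sfP].
    apply/forallP => p; apply/forallP => q; apply/implyP; rewrite !spin_sf /=.
    case: p q => [[[]|] [p pK]] [[[]|] [q qK]] //=.
    by do 10?[case: p pK => [|p] pK //]; do 10?[case: q qK => [|q] qK //];
      move=> _; rewrite /= ?f01 ?f14.
  have sfZ (p q : 'I_(1.*2 + 3).*2) :
      Z_strings (label 3 1 p) (label 3 1 q) -> f p./2 = f q./2.
    pose pt := Tagged (fun _ : option void => 'I_(1.*2 + 3).*2).
    move/forallP/(_ (pt None p))/forallP/(_ (pt None q)): sfP.
    by rewrite !spin_sf => /implyP pq /pq/eqP.
  (* The strings L_1-T_1 and T_2-R_1. *)
  have f40 := sfZ (Ordinal (isT : 9 < 10)%N) (Ordinal (isT : 0 < 10)%N) isT.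
  have f01 := sfZ (Ordinal (isT : 1 < 10)%N) (Ordinal (isT : 2 < 10)%N) isT.
  by rewrite /= in f40 f01; rewrite -f01 f40 eqxx.
rewrite big_mkcondr (big_pred1 sf)//=.
by case: (compatible _ _); rewrite // big_pred0 // => -[].
Qed.

(** Where the intervals of a and of p lie on the boundary of a.Z.p. The right
interval m of a and the left interval 2 of p both go to the top interval m that Z
adds, and p brings the intervals m+1 (right) and m+2 (bottom right). *)
Definition index_before (m j : nat) := if (j <= m)%N then j else j.+2.
Definition index_after (m j : nat) := (if j < 2 then m.+1 + j else m)%N.

Lemma hmul_Z_hmulE m (a : gjs_box R gT 3 m) (p : gjs_box R gT 3 0) f :
  hmul (hmul a (hZ R gT)) p (spins_of _ f) =
  a (spins_of _ (f \o index_before m)) * p (spins_of _ (f \o index_after m)).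
Proof.
rewrite hmulE (bigD1 (f m)) //= big1 ?addr0; last first.
  move=> x /negPf xfm; rewrite hmulE big1 ?mul0r// => y _.
  rewrite hZE /glue /= addn0 addn1 ltnSn ltnn eqxx.
  by rewrite [f m == x]eq_sym xfm mulr0.
rewrite hmulE (bigD1 (f m)) //= big1 ?addr0; last first.
  move=> y /negPf yfm; rewrite hZE /glue /= addn0 addn1 ltnSn ltnn eqxx.
  by rewrite [f m == y]eq_sym yfm andbF mulr0.
rewrite hZE /glue /= addn0 addn1 ltnSn ltnn !eqxx mulr1.
rewrite /index_before /index_after.
congr (a _ * p _); apply: eq_spins_of => j jK /=; last by case: ifP.
by case: (ltngtP j m) => jm; rewrite ?jm//;
  repeat (case: ifP => //= ?); try congr (f _); lia.
Qed.

Lemma gjs_castE m m' (e : m = m') (a : gjs_box R gT 3 m) f :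
  gjs_cast e a (spins_of _ f) = a (spins_of _ f).
Proof. by case: m' / e. Qed.

End Products.

(** * Homogeneous elements of the graded algebra *)

Section Grading.
Variables (R : realType) (gT : finGroupType) (k : nat).

Lemma homog_same m (a : gjs_box R gT k m) : homog a m = a.
Proof.
by rewrite /= /homog_fun; case: eqP => // e; rewrite (eq_irrelevance e erefl).
Qed.

Lemma homog_other m p (a : gjs_box R gT k m) : m != p -> homog a p = 0.
Proof. by rewrite /= /homog_fun; case: eqP. Qed.

Lemma homog_cast m m' (e : m = m') (a : gjs_box R gT k m) :
  homog (gjs_cast e a) = homog a.
Proof. by case: m' / e. Qed.

Lemma homog_linear m c (a b : gjs_box R gT k m) :
  homog (c *: a + b) = c *: homog a + homog b.
Proof.
apply: gjs_ext => p; change (homog (c *: a + b) p = c *: homog a p + homog b p).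
have [<-|mp] := eqVneq m p; first by rewrite !homog_same.
by rewrite !homog_other// scaler0 addr0.
Qed.

Lemma homog0 m : homog (0 : gjs_box R gT k m) = 0.
Proof.
apply: gjs_ext => p; change (homog (0 : gjs_box R gT k m) p = 0).
by have [<-|mp] := eqVneq m p; rewrite ?homog_same ?homog_other.
Qed.

Lemma homog_mul m m' (a : gjs_box R gT k m) (b : gjs_box R gT k m') :
  gjs_mul (homog a) (homog b) = homog (hmul a b).
Proof.
apply: gjs_ext => p; change (gjs_mul_fun (homog a) (homog b) p = homog (hmul a b) p).
rewrite /gjs_mul_fun; have [<-|mp] := eqVneq (m + m')%N p.
  have mlt : (m < (m + m').+1)%N by rewrite ltnS leq_addr.
  rewrite (bigD1 (Ordinal mlt)) //= big1 ?addr0 => [|i im]; last first.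
    have mi : m != i by apply: contraNneq im => mi; apply/eqP/val_inj.
    by have /= -> := homog_other a mi; rewrite hmul0l gjs_cast0.
  have homogs q (e : (m + q = m + m')%N) :
      gjs_cast e (hmul (homog a m) (homog b q)) = hmul a b.
    have qm' : q = m' by apply/(@addnI m).
    by subst q; rewrite !homog_same (eq_irrelevance e erefl).
  by rewrite [LHS]homogs -[LHS]homog_same.
rewrite homog_other // big1 // => i _.
have [mi|mi] := eqVneq m i; last first.
  by rewrite homog_other// hmul0l gjs_cast0.
rewrite [homog b _]homog_other ?hmul0r ?gjs_cast0//.
apply: contraNneq mp => ->; rewrite mi subnKC//.
exact: leq_ord.
Qed.

Lemma gjs_sumE (I : Type) (r : seq I) (F : I -> gjs R gT k) p :
  (\sum_(i <- r) F i) p = \sum_(i <- r) F i p.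
Proof. by elim/big_rec2: _ => // i _ x _ <-. Qed.

Lemma gjs_sum_homog (a : gjs R gT k) : exists N, a = \sum_(i < N) homog (a i).
Proof.
have [N aN] := gjs_valP a; exists N; apply: gjs_ext => p; rewrite gjs_sumE.
have [pN|Np] := ltnP p N; last first.
  rewrite aN// big1// => i _; apply: homog_other.
  by rewrite neq_ltn (leq_trans (ltn_ord i) Np).
rewrite (bigD1 (Ordinal pN)) //= [X in X + _]homog_same big1 ?addr0//.
move=> i ip; apply: homog_other; apply: contraNneq ip => ip.
by apply/eqP/val_inj.
Qed.

End Grading.

(** * Indicators of translation orbits *)

Section Indicators.
Variables (R : realType) (gT : finGroupType) (K : nat).

Lemma orbit_indicator_subproof (i : 'I_K) (s : spins gT K) :
  [ffun t : spins gT K => ((translate (t i)^-1%g t == s)%:R : R[i]^o)]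
    \in @left_invariant R gT K.
Proof.
apply/left_invariantP => g t; rewrite !ffunE; congr (_ == _)%:R.
by apply/ffunP => j; rewrite !ffunE invMg -mulgA mulKg.
Qed.

(** The indicator of the orbit of s if s i = 1, and 0 otherwise, as the i-th spin
is normalised to 1 before the comparison with s. *)
Definition orbit_indicator (i : 'I_K) (s : spins gT K) : box R gT K :=
  Box (orbit_indicator_subproof i s).

Lemma orbit_indicatorE (i : 'I_K) (s : spins gT K) (f : nat -> gT) :
  orbit_indicator i s (spins_of K f) =
  (spins_of K (fun j => (f i)^-1 * f j)%g == s)%:R.
Proof.
rewrite ffunE; congr (_ == _)%:R.
by apply/ffunP => j; rewrite !ffunE.
Qed.

(** Left-invariant functions are combinations of orbit indicators: only the
representative of the orbit of t with i-th spin 1 contributes to the sum. *)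
Lemma box_normalize (i : 'I_K) (a : box R gT K) (t : spins gT K) :
  a t = \sum_s a s * (translate (t i)^-1%g t == s)%:R.
Proof.
rewrite (bigD1 (translate (t i)^-1%g t)) //= eqxx mulr1 big1 ?addr0.
  by rewrite (left_invariantP _ (box_valP a)).
by move=> s /negPf; rewrite eq_sym => ->; rewrite mulr0.
Qed.

Lemma box_sumE (I : Type) (r : seq I) (c : I -> R[i]) (F : I -> box R gT K) t :
  (\sum_(i <- r) c i *: F i) t = \sum_(i <- r) c i * F i t.
Proof.
by elim/big_rec2: _ => [|i x y _ <-]; rewrite !ffunE.
Qed.

End Indicators.

(** * Generation in degree m+1 from degree m, Z and degree 0 *)

Section Generation.
Variables (R : realType) (gT : finGroupType).

Lemma right_interval_lt m : (m < m.*2 + 3)%N. Proof. lia. Qed.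
Lemma last_top_interval_lt m : (m < m.+1.*2 + 3)%N. Proof. lia. Qed.

Lemma step_degree m : (m + 1 + 0 = m.+1)%N. Proof. lia. Qed.

(** Both orbit indicators are normalised at the interval that goes to the top
interval m of the product. *)
Definition step_product m (s : spins gT (m.+1.*2 + 3)) : gjs_box R gT 3 m.+1 :=
  gjs_cast (step_degree m)
    (@hmul R gT 3 (m + 1) 0
       (@hmul R gT 3 m 1
          (orbit_indicator R (Ordinal (right_interval_lt m))
             (spins_of _ (ext s \o index_before m)))
          (hZ R gT))
       (orbit_indicator R (@ord_max 2) (spins_of _ (ext s \o index_after m)))).

(** The product is the orbit indicator of s, because the two index maps cover all
the intervals and share the interval of normalisation. *)
Lemma step_productE m (s t : spins gT (m.+1.*2 + 3)) :
  step_product s t = (translate (t (Ordinal (last_top_interval_lt m)))^-1%g t == s)%:R.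
Proof.
rewrite -[t in LHS]extK gjs_castE hmul_Z_hmulE !orbit_indicatorE.
rewrite /index_before /index_after /= leqnn.
rewrite -natrM mulnb; congr (nat_of_bool _)%:R.
set n := translate _ _; have nE j : (j < m.+1.*2 + 3)%N ->
    ((ext t m)^-1 * ext t j)%g = ext n j.
  move=> jK; rewrite -[j]/(nat_of_ord (Ordinal jK)) !ext_ord ffunE.
  by rewrite -[m in ext t m]/(nat_of_ord (Ordinal (last_top_interval_lt m))) ext_ord.
apply/idP/eqP => [/andP[/eqP ns1 /eqP ns2]|<-]; last first.
  by apply/andP; split; apply/eqP/eq_spins_of => j jK; apply: nE; case: ifP; lia.
have {}ns1 j : (j < m.*2 + 3)%N ->
    ext n (if (j <= m)%N then j else j.+2) =
    ext s (if (j <= m)%N then j else j.+2).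
  move=> jK; rewrite -nE; last by case: ifP; lia.
  by have /ffunP/(_ (Ordinal jK)) := ns1; rewrite !ffunE.
have {}ns2 j : (j < 2)%N -> ext n (m.+1 + j) = ext s (m.+1 + j).
  move=> j2; have j3 : (j < 3)%N by apply: ltnW.
  rewrite -nE; last by lia.
  by have /ffunP/(_ (Ordinal j3)) := ns2; rewrite !ffunE /= j2.
apply/ffunP => -[j jK]; rewrite -[LHS]ext_ord -[RHS]ext_ord /=.
have [jm|mj] := leqP j m; first by have := ns1 j; rewrite jm; apply; lia.
have [jm2|mj2] := ltnP j m.+3.
  by have -> : j = (m.+1 + (j - m.+1))%N; [lia | apply: ns2; lia].
have := ns1 j.-2; have -> : (j.-2 <= m)%N = false by lia.
by have -> : j.-2.+2 = j; [lia | apply; lia].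
Qed.

Lemma step_span m (a : gjs_box R gT 3 m.+1) :
  a = \sum_s a s *: step_product s.
Proof.
apply: val_inj; apply/ffunP => t; rewrite box_sumE.
rewrite [LHS](box_normalize (Ordinal (last_top_interval_lt m))).
by apply: eq_bigr => s _; rewrite step_productE.
Qed.

Lemma subalgebra_full (S : set (gjs R gT 3)) :
  is_subalgebra S -> S (Z R gT) ->
  (forall a : gjs_box R gT 3 0, S (homog a)) -> forall a, S a.
Proof.
move=> [S0 SL SM] SZ SP3 a.
have SD (I : Type) (r : seq I) (F : I -> gjs R gT 3) :
    (forall i, S (F i)) -> S (\sum_(i <- r) F i).
  move=> SF; elim/big_rec: _ => // i b _ Sb.
  by rewrite -[F i]scale1r; apply: SL.
have SmZm m (b : gjs_box R gT 3 m) : S (homog b).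
  elim: m b => // m IHm b; rewrite [b]step_span.
  elim/big_rec: _ => [|s c _ Sc]; first by rewrite homog0.
  rewrite homog_linear; apply: SL => //; rewrite homog_cast -!homog_mul.
  by apply/SM/SP3/SM.
by have [N ->] := gjs_sum_homog a; apply: SD.
Qed.

End Generation.

Local Open Scope classical_set_scope.

Theorem proposition6 (R : realType) (gT : finGroupType) (gT_nontrivial : (1 < #|gT|)%N) :
  generated_subalgebra
    ([set Z R gT] `|` range (fun a : box R gT 3 => @homog R gT 3 0 a)) =
  [set: gjs R gT 3].
Proof.
apply/seteqP; split => // a _ S [Salg genS].
apply: subalgebra_full => // [|b]; apply: genS; first by left.
by right; exists b.
Qed.
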